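(* Let $G$ be a finitely generated group. If the finite index membership problem $MP_{f.i.}(G)$ is decidable, then $GCP_{Rec}(G)$ is decidable: there is an algorithm which, given a recognizable subset $K\subseteq G$ and $g\in G$, decides whether some conjugate of $g$ in $G$ lies in $K$.
   Context: $MP_{f.i.}(G)$ is the problem of deciding, given $g\in G$ and a finite index subgroup $H\le G$, whether $g\in H$. A subset $K$ of $G$ is recognizable if its full preimage in the free monoid $\tilde A^*$ on $A\cup A^{-1}$ (for a finite generating set $A$) is a rational (regular) language; equivalently $K$ is a finite union of cosets $Hb_1\cup\cdots\cup Hb_m$ of a finite index subgroup $H\le G$, and recognizable subsets are given in this form. *)

(* Defs.v *)
(* Algorithms are modelled by an explicit Turing-complete model of
   computation (mu-recursive functions on nat with Cantor pairing), and inputs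
   (words, lists of words) are encoded as natural numbers by an explicit
   injective coding.  A Rocq function would NOT do: with the whitelisted
   classical axioms every predicate has a Rocq "decider". *)
From Stdlib Require Import Arith List.
Import ListNotations.

Definition cpair (a b : nat) : nat := (a + b) * (a + b + 1) / 2 + b.

Inductive prog : Type :=
  | PZero : prog
  | PSucc : prog
  | PId : prog
  | PFst : prog
  | PSnd : prog
  | PComp : prog -> prog -> prog
  | PPair : prog -> prog -> prog
  | PRec : prog -> prog -> prog
  | PMin : prog -> prog.

Inductive peval : prog -> nat -> nat -> Prop :=
  | ev_zero x : peval PZero x 0
  | ev_succ x : peval PSucc x (S x)
  | ev_id x : peval PId x x
  | ev_fst a b : peval PFst (cpair a b) a
  | ev_snd a b : peval PSnd (cpair a b) b
  | ev_comp f g x y z : peval g x y -> peval f y z -> peval (PComp f g) x z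
  | ev_pair f g x a b : peval f x a -> peval g x b -> peval (PPair f g) x (cpair a b)
  | ev_rec f g x k y : receval f g x k y -> peval (PRec f g) (cpair x k) y
  | ev_min f x n : peval f (cpair x n) 0 ->
      (forall m, m < n -> exists k, peval f (cpair x m) (S k)) ->
      peval (PMin f) x n
with receval : prog -> prog -> nat -> nat -> nat -> Prop :=
  | rec_0 f g x y : peval f x y -> receval f g x 0 y
  | rec_S f g x k y z : receval f g x k y -> peval g (cpair x (cpair k y)) z ->
      receval f g x (S k) z.

Definition decides (p : prog) (Q : Prop) (x : nat) : Prop :=
  (Q -> peval p x 1) /\ (~ Q -> peval p x 0).

Fixpoint enc_list (l : list nat) : nat :=
  match l with
  | [] => 0
  | a :: l' => S (cpair a (enc_list l'))
  end.

Definition enc_words (ws : list (list nat)) : nat := enc_list (map enc_list ws).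

Record Group : Type := {
  gcar :> Type;
  gmul : gcar -> gcar -> gcar;
  gone : gcar;
  ginv : gcar -> gcar;
  gmulA : forall x y z, gmul x (gmul y z) = gmul (gmul x y) z;
  gmul1 : forall x, gmul gone x = x;
  gmulV : forall x, gmul (ginv x) x = gone }.

Arguments gmul {g} _ _.
Arguments gone {g}.
Arguments ginv {g} _.

(* Words over A ∪ A^{-1}, A = {a_0,...,a_{n-1}}: letter l stands for
   a_(l/2) if l is even and a_(l/2)^{-1} if l is odd. *)
Definition word_ok (n : nat) (w : list nat) : Prop := Forall (fun l => l / 2 < n) w.

Definition eval_letter {G : Group} (gens : nat -> G) (l : nat) : G :=
  if Nat.even l then gens (l / 2) else ginv (gens (l / 2)).

Definition eval_word {G : Group} (gens : nat -> G) (w : list nat) : G :=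
  fold_right (fun l acc => gmul (eval_letter gens l) acc) gone w.

Inductive in_gen {G : Group} (S : list G) : G -> Prop :=
  | ig_one : in_gen S gone
  | ig_mem s : In s S -> in_gen S s
  | ig_mul x y : in_gen S x -> in_gen S y -> in_gen S (gmul x y)
  | ig_inv x : in_gen S x -> in_gen S (ginv x).

Definition fin_index {G : Group} (S : list G) : Prop :=
  exists ts : list G, forall x : G, exists t, In t ts /\ in_gen S (gmul x (ginv t)).

Definition generates {G : Group} (n : nat) (gens : nat -> G) : Prop :=
  forall x : G, exists w, word_ok n w /\ eval_word gens w = x.

Definition MPfi_decidable {G : Group} (n : nat) (gens : nat -> G) : Prop :=
  exists p : prog, forall (w : list nat) (hs : list (list nat)),
    word_ok n w -> Forall (word_ok n) hs ->
    fin_index (map (eval_word gens) hs) ->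
    decides p (in_gen (map (eval_word gens) hs) (eval_word gens w))
      (cpair (enc_list w) (enc_words hs)).

(* GCP_Rec(G): input a word w (for g) and a recognizable K = H b_1 ∪ ... ∪ H b_m,
   given by words hs generating the finite index subgroup H and words bs for
   the b_i; decide whether some conjugate x^{-1} g x lies in K. *)
Definition GCPRec_decidable {G : Group} (n : nat) (gens : nat -> G) : Prop :=
  exists p : prog, forall (w : list nat) (hs bs : list (list nat)),
    word_ok n w -> Forall (word_ok n) hs -> Forall (word_ok n) bs ->
    fin_index (map (eval_word gens) hs) ->
    decides p
      (exists x : G, exists b, In b bs /\
         in_gen (map (eval_word gens) hs)
           (gmul (gmul (gmul (ginv x) (eval_word gens w)) x) (ginv (eval_word gens b))))
      (cpair (enc_list w) (cpair (enc_words hs) (enc_words bs))).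

(* Main.v *)
Require Import Defs.
From Stdlib Require Import Arith List Lia Classical ClassicalEpsilon Wf_nat.
Import ListNotations.

(* Let [H] be the finite index subgroup. For a bound [M], let [B_M] ([coded_below M]) be the
   elements of [G] coded by numbers [<= M] and [N_M] ([in_core_below M]) the set of [y] with
   [u y u^-1 \in H] for all [u \in B_M].
   Call [M] closed if for every [v \in B_M] and every letter [a] some [z \in B_M] satisfies
   [v a z^-1 \in N_M]. Closedness involves finitely many membership queries, so it is
   decidable with an [MP_f.i.] oracle, and it holds for some [M]: the right action of [G] on
   the finitely many cosets of [H] takes finitely many values, and it suffices that [B_M]
   realizes each of them. For closed [M], induction on words gives [G = N_M B_M], so [N_M]
   lies in every conjugate of [H], and some conjugate [x^-1 g x] lies in [H b] iff
   [z^-1 g z b^-1 \in H] for some [z \in B_M]. The algorithm finds the least closed [M] by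
   unbounded search, then tries the finitely many [z \in B_M]; no bound on the index of [H]
   is needed. *)

(** * Cantor pairing and list codes *)

Definition tri (s : nat) : nat := s * (s + 1) / 2.

Lemma tri_S s : tri (S s) = tri s + S s.
Proof.
  unfold tri. replace (S s * (S s + 1)) with (s * (s + 1) + S s * 2) by lia.
  rewrite Nat.div_add by lia. lia.
Qed.

Lemma cpair_tri a b : cpair a b = tri (a + b) + b.
Proof. reflexivity. Qed.

Lemma tri_lt s s' : s < s' -> tri s + s < tri s'.
Proof. induction 1; rewrite tri_S; lia. Qed.

Lemma cpair_inj a b a' b' : cpair a b = cpair a' b' -> a = a' /\ b = b'.
Proof.
  rewrite !cpair_tri. intros E.
  destruct (lt_eq_lt_dec (a + b) (a' + b')) as [[Hlt | Heq] | Hlt].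
  - pose proof (tri_lt _ _ Hlt). lia.
  - rewrite Heq in E. lia.
  - pose proof (tri_lt _ _ Hlt). lia.
Qed.

(* [unpair (S z)] is the successor of [unpair z] along the Cantor diagonals. *)
Fixpoint unpair (z : nat) : nat * nat :=
  match z with
  | 0 => (0, 0)
  | S z' => match unpair z' with
            | (0, b) => (S b, 0)
            | (S a, b) => (a, S b)
            end
  end.

Definition cfst (z : nat) : nat := fst (unpair z).
Definition csnd (z : nat) : nat := snd (unpair z).

Lemma cpair_unpair z : cpair (cfst z) (csnd z) = z.
Proof.
  unfold cfst, csnd. induction z as [|z IH]; [reflexivity|].
  simpl. destruct (unpair z) as [[|a] b]; simpl in *; rewrite cpair_tri in *.
  - rewrite ?Nat.add_0_r, ?Nat.add_0_l in *. rewrite tri_S. lia.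
  - replace (a + S b) with (S a + b) by lia. lia.
Qed.

Lemma cfst_cpair a b : cfst (cpair a b) = a.
Proof. apply (cpair_inj _ _ _ _ (cpair_unpair (cpair a b))). Qed.

Lemma csnd_cpair a b : csnd (cpair a b) = b.
Proof. apply (cpair_inj _ _ _ _ (cpair_unpair (cpair a b))). Qed.

Lemma le_cpair_r a b : b <= cpair a b.
Proof. rewrite cpair_tri. lia. Qed.

Ltac unpair_simpl := repeat (rewrite ?cfst_cpair, ?csnd_cpair in *).

Lemma enc_list_inj l1 l2 : enc_list l1 = enc_list l2 -> l1 = l2.
Proof.
  revert l2; induction l1 as [|a l1 IH]; intros [|b l2]; simpl; try discriminate; auto.
  intros E. injection E as E. apply cpair_inj in E as [-> E]. f_equal; auto.
Qed.

Lemma enc_list_surj c : exists l, enc_list l = c.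
Proof.
  induction c as [c IH] using (well_founded_induction lt_wf).
  destruct c as [|c]; [exists []; reflexivity|].
  destruct (IH (csnd c)) as [l Hl].
  { pose proof (le_cpair_r (cfst c) (csnd c)). rewrite cpair_unpair in H. lia. }
  exists (cfst c :: l). simpl. rewrite Hl, cpair_unpair. reflexivity.
Qed.

Lemma length_le_enc_list l : length l <= enc_list l.
Proof. induction l as [|a l IH]; simpl; [lia|]. pose proof (le_cpair_r a (enc_list l)). lia. Qed.

Definition dec_list (c : nat) : list nat :=
  proj1_sig (constructive_indefinite_description _ (enc_list_surj c)).

Lemma enc_dec_list c : enc_list (dec_list c) = c.
Proof. unfold dec_list. destruct (constructive_indefinite_description _ _); auto. Qed.

Lemma dec_enc_list l : dec_list (enc_list l) = l.
Proof. apply enc_list_inj, enc_dec_list. Qed.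

Definition nat_reflect (Q : Prop) (v : nat) : Prop := (Q -> v = 1) /\ (~ Q -> v = 0).

Lemma nat_reflect_iff Q Q' v : (Q <-> Q') -> nat_reflect Q v -> nat_reflect Q' v.
Proof. unfold nat_reflect. tauto. Qed.

Lemma nat_reflect_cases Q v : nat_reflect Q v -> (Q /\ v = 1) \/ (~ Q /\ v = 0).
Proof. intros [R1 R0]. destruct (classic Q); [left | right]; auto. Qed.

Definition indicator (Q : Prop) : nat := if excluded_middle_informative Q then 1 else 0.

Lemma nat_reflect_indicator Q : nat_reflect Q (indicator Q).
Proof. unfold indicator. destruct (excluded_middle_informative Q); split; tauto. Qed.

Lemma peval_of_decides p Q x v : decides p Q x -> nat_reflect Q v -> peval p x v.
Proof.
  intros [D1 D0] [R1 R0]. destruct (classic Q) as [HQ | HQ].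
  - rewrite (R1 HQ). exact (D1 HQ).
  - rewrite (R0 HQ). exact (D0 HQ).
Qed.

Lemma decides_of_peval p Q x v : peval p x v -> nat_reflect Q v -> decides p Q x.
Proof.
  intros Hp [R1 R0]. split; intros HQ; [rewrite <- (R1 HQ) | rewrite <- (R0 HQ)]; exact Hp.
Qed.

Lemma peval_fst z : peval PFst z (cfst z).
Proof. rewrite <- (cpair_unpair z) at 1. constructor. Qed.

Lemma peval_snd z : peval PSnd z (csnd z).
Proof. rewrite <- (cpair_unpair z) at 1. constructor. Qed.

Lemma peval_min_least f x (F : nat -> nat) M :
  (forall m, peval f (cpair x m) (F m)) -> F M = 0 -> (forall m, m < M -> F m <> 0) ->
  peval (PMin f) x M.
Proof.
  intros Hf HM Hlt. constructor.
  - rewrite <- HM. apply Hf.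
  - intros m Hm. destruct (F m) as [|k] eqn:E; [exfalso; exact (Hlt m Hm E)|].
    exists k. rewrite <- E. apply Hf.
Qed.

(** * Expressions with an oracle *)

Inductive exp : Type :=
  | EVar | EZero | ESucc (a : exp) | EFst (a : exp) | ESnd (a : exp)
  | EPair (a b : exp) | EComp (a b : exp) | ERec (b s : exp) | EOracle (a : exp).

Fixpoint prim_rec (base step : nat -> nat) (x k : nat) : nat :=
  match k with
  | 0 => base x
  | S k => step (cpair x (cpair k (prim_rec base step x k)))
  end.

Lemma prim_rec_iter base step x g :
  (forall k y, step (cpair x (cpair k y)) = g y) ->
  forall k, prim_rec base step x k = Nat.iter k g (base x).
Proof. intros Hg k. induction k as [|k IH]; simpl; [reflexivity|]. rewrite Hg, IH. reflexivity. Qed.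

Fixpoint exp_den (O : nat -> nat) (E : exp) (e : nat) : nat :=
  match E with
  | EVar => e
  | EZero => 0
  | ESucc a => S (exp_den O a e)
  | EFst a => cfst (exp_den O a e)
  | ESnd a => csnd (exp_den O a e)
  | EPair a b => cpair (exp_den O a e) (exp_den O b e)
  | EComp a b => exp_den O a (exp_den O b e)
  | ERec b s => prim_rec (exp_den O b) (exp_den O s) (cfst e) (csnd e)
  | EOracle a => O (exp_den O a e)
  end.

Definition p_assoc_r : prog := PPair (PComp PFst PFst) (PPair (PComp PSnd PFst) PSnd).
Definition p_assoc_l : prog := PPair (PPair PFst (PComp PFst PSnd)) (PComp PSnd PSnd).

Lemma peval_assoc_r a b c : peval p_assoc_r (cpair (cpair a b) c) (cpair a (cpair b c)).
Proof. repeat econstructor. Qed.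

Lemma peval_assoc_l a b c : peval p_assoc_l (cpair a (cpair b c)) (cpair (cpair a b) c).
Proof. repeat econstructor. Qed.

(* [compile orc E] runs on [cpair h e]; the parameter [h] is passed unchanged to every
   oracle call [orc]. *)
Fixpoint compile (orc : prog) (E : exp) : prog :=
  match E with
  | EVar => PSnd
  | EZero => PZero
  | ESucc a => PComp PSucc (compile orc a)
  | EFst a => PComp PFst (compile orc a)
  | ESnd a => PComp PSnd (compile orc a)
  | EPair a b => PPair (compile orc a) (compile orc b)
  | EComp a b => PComp (compile orc a) (PPair PFst (compile orc b))
  | ERec b s => PComp (PRec (compile orc b) (PComp (compile orc s) p_assoc_r)) p_assoc_l
  | EOracle a => PComp orc (PPair PFst (compile orc a))
  end.

Theorem compile_correct orc O h :
  (forall c, peval orc (cpair h c) (O c)) ->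
  forall E e, peval (compile orc E) (cpair h e) (exp_den O E e).
Proof.
  intros Horc E. induction E; intros e; simpl.
  - constructor.
  - constructor.
  - econstructor; [apply IHE | constructor].
  - econstructor; [apply IHE | apply peval_fst].
  - econstructor; [apply IHE | apply peval_snd].
  - constructor; auto.
  - econstructor; [| apply IHE1]. constructor; [constructor | apply IHE2].
  - rewrite <- (cpair_unpair e) at 1.
    econstructor; [apply peval_assoc_l |]. constructor.
    induction (csnd e) as [|k IHk]; simpl.
    + constructor. apply IHE1.
    + econstructor; [exact IHk |]. econstructor; [apply peval_assoc_r | apply IHE2].
  - econstructor; [| apply Horc]. constructor; [constructor | apply IHE].
Qed.

Section Macros.
Variable O : nat -> nat.
Local Notation den := (exp_den O).
Local Ltac den_simpl := cbn [exp_den prim_rec]; unpair_simpl.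

Fixpoint EConst (k : nat) : exp := match k with 0 => EZero | S k => ESucc (EConst k) end.

Lemma den_EConst k e : den (EConst k) e = k.
Proof. induction k; simpl; auto. Qed.

Definition EIfz (c a b : exp) : exp := EComp (ERec a (EComp b (EFst EVar))) (EPair EVar c).

Lemma den_EIfz c a b e :
  den (EIfz c a b) e = match den c e with 0 => den a e | S _ => den b e end.
Proof. unfold EIfz. den_simpl. destruct (den c e); simpl; unpair_simpl; reflexivity. Qed.

Definition EPred (a : exp) : exp := EComp (ERec EZero (EFst (ESnd EVar))) (EPair EVar a).

Lemma den_EPred a e : den (EPred a) e = pred (den a e).
Proof. unfold EPred. den_simpl. destruct (den a e); simpl; unpair_simpl; reflexivity. Qed.

Definition ESub (a b : exp) : exp :=
  EComp (ERec EVar (EPred (ESnd (ESnd EVar)))) (EPair a b).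

Lemma den_ESub a b e : den (ESub a b) e = den a e - den b e.
Proof.
  unfold ESub. den_simpl. induction (den b e) as [|k IH]; cbn [prim_rec]; [lia|].
  rewrite den_EPred. den_simpl. rewrite IH. lia.
Qed.

Definition ENot (a : exp) : exp := EIfz a (EConst 1) EZero.
Definition EAnd (a b : exp) : exp := EIfz a EZero b.
Definition EOr (a b : exp) : exp := EIfz a b (EConst 1).

Lemma den_ENot a e : den (ENot a) e = match den a e with 0 => 1 | S _ => 0 end.
Proof. unfold ENot. rewrite den_EIfz. reflexivity. Qed.

Lemma nat_reflect_ENot Q a e : nat_reflect Q (den a e) -> nat_reflect (~ Q) (den (ENot a) e).
Proof.
  rewrite den_ENot. intros R. destruct (nat_reflect_cases _ _ R) as [[HQ ->] | [HQ ->]];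
    split; tauto.
Qed.

Lemma nat_reflect_EAnd P Q a b e :
  nat_reflect P (den a e) -> nat_reflect Q (den b e) -> nat_reflect (P /\ Q) (den (EAnd a b) e).
Proof.
  unfold EAnd. rewrite den_EIfz. intros RP RQ.
  destruct (nat_reflect_cases _ _ RP) as [[HP ->] | [HP ->]].
  - apply (nat_reflect_iff Q); tauto.
  - split; tauto.
Qed.

Lemma nat_reflect_EOr P Q a b e :
  nat_reflect P (den a e) -> nat_reflect Q (den b e) -> nat_reflect (P \/ Q) (den (EOr a b) e).
Proof.
  unfold EOr. rewrite den_EIfz. intros RP RQ.
  destruct (nat_reflect_cases _ _ RP) as [[HP ->] | [HP ->]].
  - split; [reflexivity | tauto].
  - apply (nat_reflect_iff Q); tauto.
Qed.

Definition EParity (a : exp) : exp :=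
  EComp (ERec EZero (ENot (ESnd (ESnd EVar)))) (EPair EVar a).

Lemma den_EParity a e : den (EParity a) e = Nat.b2n (Nat.odd (den a e)).
Proof.
  unfold EParity. den_simpl. induction (den a e) as [|k IH]; cbn [prim_rec]; [reflexivity|].
  rewrite den_ENot. den_simpl. rewrite IH, Nat.odd_succ, <- Nat.negb_odd.
  destruct (Nat.odd k); reflexivity.
Qed.

Definition flip_letter (l : nat) : nat := if Nat.even l then S l else pred l.

Definition EFlip (a : exp) : exp := EIfz (EParity a) (ESucc a) (EPred a).

Lemma den_EFlip a e : den (EFlip a) e = flip_letter (den a e).
Proof.
  unfold EFlip, flip_letter. rewrite den_EIfz, den_EParity, den_EPred, <- Nat.negb_odd.
  destruct (Nat.odd (den a e)); reflexivity.
Qed.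

Definition ECons (a l : exp) : exp := ESucc (EPair a l).

Lemma den_ECons a l e x u : den a e = x -> den l e = enc_list u ->
  den (ECons a l) e = enc_list (x :: u).
Proof. intros Ha Hl. unfold ECons. cbn [exp_den]. rewrite Ha, Hl. reflexivity. Qed.

(* On states [cpair code acc], pops the head [x] of the list code and applies [f] to
   [cpair e (cpair x acc)]. *)
Definition EFoldStep (f : exp) : exp :=
  EIfz (EFst (ESnd (ESnd EVar))) (ESnd (ESnd EVar))
    (EPair (ESnd (EPred (EFst (ESnd (ESnd EVar)))))
       (EComp f (EPair (EFst EVar)
                   (EPair (EFst (EPred (EFst (ESnd (ESnd EVar))))) (ESnd (ESnd (ESnd EVar))))))).

Lemma den_EFoldStep f e k y :
  den (EFoldStep f) (cpair e (cpair k y)) =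
  match cfst y with
  | 0 => y
  | S r => cpair (csnd r) (den f (cpair e (cpair (cfst r) (csnd y))))
  end.
Proof.
  unfold EFoldStep. rewrite den_EIfz. den_simpl.
  destruct (cfst y) eqn:E; [reflexivity|]. rewrite !den_EPred. den_simpl. rewrite E. reflexivity.
Qed.

(* The step is iterated [den L e] times, which is at least the length of the list. *)
Definition EFold (f i L : exp) : exp :=
  ESnd (EComp (ERec (EPair L i) (EFoldStep f)) (EPair EVar L)).

Lemma den_EFold f i L e l : den L e = enc_list l ->
  den (EFold f i L) e = fold_left (fun acc a => den f (cpair e (cpair a acc))) l (den i e).
Proof.
  intros HL. unfold EFold. den_simpl.
  erewrite prim_rec_iter by (intros; apply den_EFoldStep). den_simpl. rewrite HL.
  set (step := fun y => _).
  assert (Hiter : forall l0 acc K, length l0 <= K ->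
    Nat.iter K step (cpair (enc_list l0) acc)
    = cpair 0 (fold_left (fun acc a => den f (cpair e (cpair a acc))) l0 acc)).
  { induction l0 as [|a l0 IH]; intros acc K HK.
    - induction K as [|K IHK]; [reflexivity|].
      rewrite Nat.iter_succ, IHK by (simpl; lia). unfold step. unpair_simpl. reflexivity.
    - destruct K as [|K]; [simpl in HK; lia|].
      rewrite Nat.iter_succ_r. unfold step at 2. cbn [enc_list fold_left]. unpair_simpl.
      apply IH. simpl in HK; lia. }
  rewrite Hiter by apply length_le_enc_list. apply csnd_cpair.
Qed.

Definition ERevMapOnto (g L i : exp) : exp :=
  EFold (ECons (EComp g (EFst (ESnd EVar))) (ESnd (ESnd EVar))) i L.

Lemma den_ERevMapOnto g gf L i e u v :
  (forall a, den g a = gf a) -> den L e = enc_list u -> den i e = enc_list v ->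
  den (ERevMapOnto g L i) e = enc_list (rev (map gf u) ++ v).
Proof.
  intros Hg HL Hi. unfold ERevMapOnto. rewrite (den_EFold _ _ _ _ u HL), Hi.
  clear HL Hi. revert v. induction u as [|a u IH]; intros v; [reflexivity|].
  cbn [fold_left map rev]. unfold ECons. den_simpl. rewrite Hg, <- app_assoc.
  apply (IH (gf a :: v)).
Qed.

Definition ERev (L : exp) : exp := ERevMapOnto EVar L EZero.
Definition EApp (L1 L2 : exp) : exp := ERevMapOnto EVar (ERev L1) L2.
Definition EInvWord (L : exp) : exp := ERevMapOnto (EFlip EVar) L EZero.

Lemma den_ERev L e u : den L e = enc_list u -> den (ERev L) e = enc_list (rev u).
Proof.
  intros HL. unfold ERev. rewrite (den_ERevMapOnto _ id _ _ _ u []), map_id, app_nil_r;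
    reflexivity || assumption.
Qed.

Lemma den_EApp L1 L2 e u v : den L1 e = enc_list u -> den L2 e = enc_list v ->
  den (EApp L1 L2) e = enc_list (u ++ v).
Proof.
  intros H1 H2. unfold EApp.
  rewrite (den_ERevMapOnto _ id _ _ _ (rev u) v), map_id, rev_involutive;
    [reflexivity | reflexivity | apply den_ERev | ]; assumption.
Qed.

Lemma den_EInvWord L e u : den L e = enc_list u ->
  den (EInvWord L) e = enc_list (rev (map flip_letter u)).
Proof.
  intros HL. unfold EInvWord. rewrite (den_ERevMapOnto _ flip_letter _ _ _ u []), app_nil_r;
    [reflexivity | apply den_EFlip | assumption | reflexivity].
Qed.

Definition EFilterLt (N : nat) (L : exp) : exp :=
  ERev (EFold (EIfz (ESub (EConst N) (EFst (ESnd EVar))) (ESnd (ESnd EVar))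
                 (ECons (EFst (ESnd EVar)) (ESnd (ESnd EVar)))) EZero L).

Lemma den_EFilterLt N L e u : den L e = enc_list u ->
  den (EFilterLt N L) e = enc_list (filter (fun a => a <? N) u).
Proof.
  intros HL. unfold EFilterLt. rewrite <- (rev_involutive (filter _ u)). apply den_ERev.
  rewrite (den_EFold _ _ _ _ u HL). change (den EZero e) with (enc_list []).
  rewrite <- (app_nil_r (rev _)). generalize (@nil nat) as v. clear HL.
  induction u as [|a u IH]; intros v; [reflexivity|].
  cbn [fold_left filter]. rewrite den_EIfz, den_ESub, den_EConst. den_simpl.
  destruct (Nat.ltb_spec a N) as [Ha | Ha].
  - replace (N - a) with (S (N - a - 1)) by lia. unfold ECons. den_simpl.
    cbn [rev]. rewrite <- app_assoc. apply (IH (a :: v)).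
  - replace (N - a) with 0 by lia. apply IH.
Qed.

Definition EAllLt (K P : exp) : exp :=
  EComp (ERec (EConst 1) (EAnd (ESnd (ESnd EVar)) (EComp P (EPair (EFst EVar) (EFst (ESnd EVar))))))
    (EPair EVar K).

Lemma nat_reflect_EAllLt (Q : nat -> Prop) K P e k : den K e = k ->
  (forall j, j < k -> nat_reflect (Q j) (den P (cpair e j))) ->
  nat_reflect (forall j, j < k -> Q j) (den (EAllLt K P) e).
Proof.
  unfold EAllLt. den_simpl. intros <- HP. induction (den K e) as [|k IH]; cbn [prim_rec].
  - rewrite den_EConst. split; [reflexivity | intros HQ; exfalso; apply HQ; lia].
  - apply (nat_reflect_iff ((forall j, j < k -> Q j) /\ Q k)).
    { split; [intros [H1 H2] j Hj | intros H; split; auto].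
      destruct (Nat.eq_dec j k) as [-> | Hne]; auto. apply H1. lia. }
    apply nat_reflect_EAnd; den_simpl; auto.
Qed.

Definition EExLt (K P : exp) : exp :=
  EComp (ERec EZero (EOr (ESnd (ESnd EVar)) (EComp P (EPair (EFst EVar) (EFst (ESnd EVar))))))
    (EPair EVar K).

Lemma nat_reflect_EExLt (Q : nat -> Prop) K P e k : den K e = k ->
  (forall j, j < k -> nat_reflect (Q j) (den P (cpair e j))) ->
  nat_reflect (exists j, j < k /\ Q j) (den (EExLt K P) e).
Proof.
  unfold EExLt. den_simpl. intros <- HP. induction (den K e) as [|k IH]; cbn [prim_rec].
  - split; [intros [j [Hj _]]; lia | reflexivity].
  - apply (nat_reflect_iff ((exists j, j < k /\ Q j) \/ Q k)).
    { split; [intros [[j [Hj HQ]] | HQ]; eauto | intros [j [Hj HQ]]].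
      destruct (Nat.eq_dec j k) as [-> | Hne]; [auto | left; exists j; split; auto; lia]. }
    apply nat_reflect_EOr; den_simpl; auto.
Qed.

Definition EExIn (L P : exp) : exp :=
  EFold (EOr (ESnd (ESnd EVar)) (EComp P (EPair (EFst EVar) (EFst (ESnd EVar))))) EZero L.

Lemma nat_reflect_EExIn (Q : nat -> Prop) L P e l : den L e = enc_list l ->
  (forall a, In a l -> nat_reflect (Q a) (den P (cpair e a))) ->
  nat_reflect (exists a, In a l /\ Q a) (den (EExIn L P) e).
Proof.
  intros HL HP. unfold EExIn. rewrite (den_EFold _ _ _ _ l HL).
  apply (nat_reflect_iff (False \/ exists a, In a l /\ Q a)); [tauto|].
  assert (Hinit : nat_reflect False (den EZero e)) by (split; tauto).
  revert Hinit. generalize (den EZero e) as acc. generalize False as R. clear HL.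
  induction l as [|a l IH]; intros R acc HR; cbn [fold_left].
  - apply (nat_reflect_iff R); [firstorder | exact HR].
  - apply (nat_reflect_iff ((R \/ Q a) \/ exists b, In b l /\ Q b)).
    { split; [intros [[HR' | HQ] | [b [Hb HQ]]] | intros [HR' | [b [[<- | Hb] HQ]]]];
        eauto 6 using in_eq, in_cons. }
    apply IH; [intros b Hb; apply HP; right; exact Hb |].
    apply nat_reflect_EOr; den_simpl; auto using in_eq.
Qed.

End Macros.

(** * Groups and words *)

Local Notation "x ** y" := (gmul x y) (at level 40, left associativity).

Section GroupLaws.
Variable G : Group.
Implicit Types x y z : G.

Lemma gmulAr x y z : x ** y ** z = x ** (y ** z).
Proof. symmetry. apply gmulA. Qed.

Lemma gmulxV x : x ** ginv x = gone.
Proof.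
  rewrite <- (gmul1 _ (x ** ginv x)), <- (gmulV _ (ginv x)) at 1.
  rewrite gmulAr, <- (gmulAr (ginv x) x), gmulV, gmul1, gmulV. reflexivity.
Qed.

Lemma gmulx1 x : x ** gone = x.
Proof. rewrite <- (gmulV _ x), gmulA, gmulxV, gmul1. reflexivity. Qed.

Lemma gmulKV x y : ginv x ** (x ** y) = y.
Proof. rewrite gmulA, gmulV, gmul1. reflexivity. Qed.

Lemma gmulVK x y : x ** (ginv x ** y) = y.
Proof. rewrite gmulA, gmulxV, gmul1. reflexivity. Qed.

Lemma ginv_unique x y : x ** y = gone -> ginv x = y.
Proof. intros E. rewrite <- (gmulx1 (ginv x)), <- E, gmulKV. reflexivity. Qed.

Lemma ginvK x : ginv (ginv x) = x.
Proof. apply ginv_unique, gmulV. Qed.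

Lemma ginvM x y : ginv (x ** y) = ginv y ** ginv x.
Proof. apply ginv_unique. rewrite gmulAr, (gmulA _ y), gmulxV, gmul1, gmulxV. reflexivity. Qed.

Lemma ginv1 : ginv (@gone G) = gone.
Proof. apply ginv_unique, gmul1. Qed.

Lemma in_gen_eq (S : list G) x y : in_gen S x -> x = y -> in_gen S y.
Proof. intros Hx <-. exact Hx. Qed.

End GroupLaws.

Ltac gsimpl := repeat progress rewrite ?gmulAr, ?ginvM, ?ginvK, ?ginv1, ?gmulV, ?gmulxV,
  ?gmul1, ?gmulx1, ?gmulKV, ?gmulVK.

Lemma div2_double m : (2 * m) / 2 = m.
Proof. symmetry. apply (Nat.div_unique _ _ _ 0); lia. Qed.

Lemma div2_double_S m : (2 * m + 1) / 2 = m.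
Proof. symmetry. apply (Nat.div_unique _ _ _ 1); lia. Qed.

Section Words.
Variables (G : Group) (n : nat) (gens : nat -> G).
Local Notation ev := (eval_word gens).

Lemma eval_word_cons l u : ev (l :: u) = eval_letter gens l ** ev u.
Proof. reflexivity. Qed.

Lemma eval_word_app u v : ev (u ++ v) = ev u ** ev v.
Proof.
  induction u as [|a u IH]; simpl; [rewrite gmul1; reflexivity|].
  unfold eval_word in *. simpl. rewrite IH. gsimpl. reflexivity.
Qed.

Lemma flip_letter_cases l :
  exists m, (l = 2 * m /\ flip_letter l = 2 * m + 1) \/ (l = 2 * m + 1 /\ flip_letter l = 2 * m).
Proof.
  unfold flip_letter. destruct (Nat.even l) eqn:E.
  - apply Nat.even_spec in E as [m ->]. exists m. left. split; lia.
  - assert (Hodd : Nat.odd l = true) by (rewrite <- Nat.negb_even, E; reflexivity).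
    apply Nat.odd_spec in Hodd as [m ->]. exists m. right. split; lia.
Qed.

Lemma eval_letter_even m : eval_letter gens (2 * m) = gens m.
Proof. unfold eval_letter. rewrite Nat.even_mul, div2_double. reflexivity. Qed.

Lemma eval_letter_odd m : eval_letter gens (2 * m + 1) = ginv (gens m).
Proof.
  unfold eval_letter. rewrite div2_double_S, Nat.add_comm, Nat.even_add_mul_2. reflexivity.
Qed.

Lemma eval_letter_flip l : eval_letter gens (flip_letter l) = ginv (eval_letter gens l).
Proof.
  destruct (flip_letter_cases l) as [m [[-> ->] | [-> ->]]];
    rewrite ?eval_letter_even, ?eval_letter_odd, ?ginvK; reflexivity.
Qed.

Lemma eval_word_inv u : ev (rev (map flip_letter u)) = ginv (ev u).
Proof.
  induction u as [|a u IH]; simpl; [rewrite ginv1; reflexivity|].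
  rewrite eval_word_app, IH. unfold eval_word at 2 3. simpl. rewrite eval_letter_flip.
  gsimpl. reflexivity.
Qed.

Definition restrict_word (u : list nat) : list nat := filter (fun a => a <? 2 * n) u.

Lemma restrict_word_app u v : restrict_word (u ++ v) = restrict_word u ++ restrict_word v.
Proof. apply filter_app. Qed.

Lemma flip_letter_ltb l : (flip_letter l <? 2 * n) = (l <? 2 * n).
Proof.
  destruct (flip_letter_cases l) as [m [[-> ->] | [-> ->]]];
    destruct (Nat.ltb_spec (2 * m) (2 * n)), (Nat.ltb_spec (2 * m + 1) (2 * n));
    reflexivity || lia.
Qed.

Lemma restrict_word_cons l u : l < 2 * n -> restrict_word (l :: u) = l :: restrict_word u.
Proof.
  intros Hl. unfold restrict_word. cbn [filter]. apply Nat.ltb_lt in Hl. rewrite Hl. reflexivity.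
Qed.

Lemma restrict_word_inv u :
  restrict_word (rev (map flip_letter u)) = rev (map flip_letter (restrict_word u)).
Proof.
  induction u as [|a u IH]; [reflexivity|].
  cbn [map rev]. rewrite restrict_word_app, IH. unfold restrict_word at 2 3. cbn [filter].
  rewrite flip_letter_ltb. destruct (a <? 2 * n); cbn [map rev]; rewrite ?app_nil_r; reflexivity.
Qed.

Lemma restrict_word_id w : word_ok n w -> restrict_word w = w.
Proof.
  intros Hw. unfold restrict_word. apply forallb_filter_id, forallb_forall.
  intros l Hl. apply Nat.ltb_lt. unfold word_ok in Hw. rewrite Forall_forall in Hw.
  specialize (Hw l Hl).
  pose proof (Nat.div_mod l 2). pose proof (Nat.mod_upper_bound l 2). lia.
Qed.

Lemma word_ok_restrict u : word_ok n (restrict_word u).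
Proof.
  apply Forall_forall. intros l Hl. apply filter_In in Hl as [_ Hl].
  apply Nat.ltb_lt in Hl. apply Nat.Div0.div_lt_upper_bound; lia.
Qed.

End Words.

(** * A finite transversal modulo a partial core *)

Fixpoint tuples {A : Type} (ts : list A) (k : nat) : list (list A) :=
  match k with
  | 0 => [[]]
  | S k => flat_map (fun t => map (cons t) (tuples ts k)) ts
  end.

Lemma in_tuples_Forall2 {A B : Type} (R : A -> B -> Prop) (ts : list B) l s :
  (forall a b, R a b -> In b ts) -> Forall2 R l s -> In s (tuples ts (length l)).
Proof.
  intros HR F. induction F as [|a b l s Hab F IH]; simpl; [auto|].
  apply in_flat_map. exists b. split; [exact (HR _ _ Hab) | apply in_map, IH].
Qed.

Lemma Forall2_common {A B : Type} (R1 R2 : A -> B -> Prop) l s :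
  Forall2 R1 l s -> Forall2 R2 l s -> forall a, In a l -> exists b, R1 a b /\ R2 a b.
Proof.
  intros F1. induction F1 as [|a b l s H1 F1 IH]; intros F2 x Hx; [destruct Hx|].
  inversion F2; subst. destruct Hx as [<- | Hx]; eauto.
Qed.

Section Transversal.
Variables (G : Group) (n : nat) (gens : nat -> G) (Hs : list G).
Hypothesis Hgen : generates n gens.
Local Notation H := (in_gen Hs).

Definition elt_of_code (c : nat) : G := eval_word gens (restrict_word n (dec_list c)).

Definition coded_below (M : nat) (y : G) : Prop := exists c, c <= M /\ y = elt_of_code c.

Definition in_core_below (M : nat) (y : G) : Prop :=
  forall u, coded_below M u -> H (u ** y ** ginv u).

Definition closed_below (M : nat) : Prop :=
  forall v a, coded_below M v -> a < 2 * n ->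
  exists z, coded_below M z /\ in_core_below M (v ** eval_letter gens a ** ginv z).

Lemma elt_of_code_enc l : elt_of_code (enc_list l) = eval_word gens (restrict_word n l).
Proof. unfold elt_of_code. rewrite dec_enc_list. reflexivity. Qed.

Lemma elt_of_code_surj x : exists c, elt_of_code c = x.
Proof.
  destruct (Hgen x) as [w [Hw <-]]. exists (enc_list w).
  rewrite elt_of_code_enc, restrict_word_id by exact Hw. reflexivity.
Qed.

Lemma coded_below_1 M : coded_below M gone.
Proof. exists 0. split; [lia|]. exact (eq_sym (elt_of_code_enc [])). Qed.

Lemma coded_below_mono M M' y : M <= M' -> coded_below M y -> coded_below M' y.
Proof. intros HM [c [Hc ->]]. exists c. split; [lia | reflexivity]. Qed.

Lemma in_core_below_mul M x y :
  in_core_below M x -> in_core_below M y -> in_core_below M (x ** y).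
Proof.
  intros Hx Hy u Hu. eapply in_gen_eq; [apply ig_mul; [exact (Hx u Hu) | exact (Hy u Hu)]|].
  gsimpl. reflexivity.
Qed.

Lemma closed_below_cover M : closed_below M ->
  forall x, exists z, coded_below M z /\ in_core_below M (x ** ginv z).
Proof.
  intros Hcl x. destruct (Hgen x) as [w [Hw <-]].
  induction w as [|a w IH] using rev_ind.
  - exists gone. split; [apply coded_below_1|]. intros u _.
    eapply in_gen_eq; [apply ig_one|]. unfold eval_word. simpl. gsimpl. reflexivity.
  - unfold word_ok in Hw. apply Forall_app in Hw as [Hw Ha]. inversion Ha as [|? ? Ha' _]; subst.
    destruct (IH Hw) as [z [Hz Nz]].
    destruct (Hcl z a Hz) as [z' [Hz' Nz']].
    { pose proof (Nat.div_mod a 2). pose proof (Nat.mod_upper_bound a 2). lia. }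
    exists z'. split; [exact Hz'|].
    replace (eval_word gens (w ++ [a]) ** ginv z')
      with ((eval_word gens w ** ginv z) ** (z ** eval_letter gens a ** ginv z')).
    + apply in_core_below_mul; assumption.
    + rewrite eval_word_app. unfold eval_word at 3. simpl. gsimpl. reflexivity.
Qed.

(* [y = k z] with [k] in the core below [M], [z] coded below [M], and [k \in H] since [1] is
   coded below [M]. *)
Lemma in_core_below_conj M : closed_below M ->
  forall m, in_core_below M m -> forall y, H (y ** m ** ginv y).
Proof.
  intros Hcl m Hm y. destruct (closed_below_cover M Hcl y) as [z [Hz Nz]].
  assert (Hk : H (y ** ginv z)).
  { eapply in_gen_eq; [exact (Nz gone (coded_below_1 M))|]. gsimpl. reflexivity. }
  eapply in_gen_eq;
    [apply ig_mul; [apply ig_mul; [exact Hk | exact (Hm z Hz)] | apply ig_inv, Hk]|].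
  gsimpl. reflexivity.
Qed.

Lemma conj_coset_coded_below M : closed_below M -> forall g b,
  (exists x, H (ginv x ** g ** x ** ginv b)) <->
  (exists z, coded_below M z /\ H (ginv z ** g ** z ** ginv b)).
Proof.
  intros Hcl g b. split; [| intros [z [_ Hz]]; eauto].
  intros [x Hx]. destruct (closed_below_cover M Hcl x) as [z [Hz Nz]].
  exists z. split; [exact Hz|].
  pose proof (in_core_below_conj M Hcl _ Nz) as C.
  assert (Ci : forall y, H (y ** ginv (x ** ginv z) ** ginv y)).
  { intros y. eapply in_gen_eq; [apply ig_inv, (C y)|]. gsimpl. reflexivity. }
  eapply in_gen_eq;
    [apply ig_mul; [apply ig_mul; [apply (Ci (ginv z ** g)) | apply (C (ginv z))] | exact Hx]|].
  gsimpl. reflexivity.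
Qed.

Lemma coded_witnesses {A : Type} (L : list A) (R : A -> G -> Prop) :
  exists M, forall s, In s L -> (exists x, R s x) -> exists z, coded_below M z /\ R s z.
Proof.
  induction L as [|s L [M IH]]; [exists 0; intros s [] |].
  destruct (classic (exists x, R s x)) as [[x Hx] | Hnone].
  - destruct (elt_of_code_surj x) as [c Hc]. exists (max M c).
    intros s' [<- | Hs'] Hex.
    + exists x. split; [exists c; split; [lia | auto] | exact Hx].
    + destruct (IH s' Hs' Hex) as [z [Hz HR]].
      exists z. split; [eapply coded_below_mono; [| exact Hz]; lia | exact HR].
  - exists M. intros s' [<- | Hs'] Hex; [contradiction | exact (IH s' Hs' Hex)].
Qed.

(* [s] lists, for each representative [t] in [ts], a representative of the coset [H t x]. *)
Definition coset_action (ts : list G) (x : G) (s : list G) : Prop :=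
  Forall2 (fun t t' => In t' ts /\ H (t ** x ** ginv t')) ts s.

Hypothesis Hfi : fin_index Hs.

(* Only finitely many coset actions occur, so a single bound [M] realizes all of them. *)
Lemma exists_closed_below : exists M, closed_below M.
Proof.
  destruct Hfi as [ts Hts].
  assert (Hact : forall x l, exists s, Forall2 (fun t t' => In t' ts /\ H (t ** x ** ginv t')) l s).
  { intros x l. induction l as [|t l [s Hs']]; [exists []; constructor|].
    destruct (Hts (t ** x)) as [t' [Ht' Hh]]. exists (t' :: s). constructor; auto. }
  destruct (coded_witnesses (tuples ts (length ts)) (fun s z => coset_action ts z s)) as [M HM].
  exists M. intros v a _ _.
  destruct (Hact (v ** eval_letter gens a) ts) as [s Hs'].
  destruct (HM s (in_tuples_Forall2 _ _ _ _ (fun _ _ H' => proj1 H') Hs') (ex_intro _ _ Hs'))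
    as [z [Hz Hzs]].
  exists z. split; [exact Hz|]. intros u _.
  destruct (Hts u) as [t [Ht Hut]].
  destruct (Forall2_common _ _ _ _ Hs' Hzs t Ht) as [t' [[_ H1] [_ H2]]].
  eapply in_gen_eq;
    [apply ig_mul; [apply ig_mul; [apply ig_mul; [exact Hut | exact H1] | apply ig_inv, H2]
                   | apply ig_inv, Hut]|].
  gsimpl. reflexivity.
Qed.

End Transversal.

(** * The decision procedure *)

(* Environment [<<<<M, c>, a>, c'>, c''>]; the word is [c'' c a c'^-1 c''^-1]. *)
Definition conj_word_exp : exp :=
  EApp (ESnd EVar)
    (EApp (ESnd (EFst (EFst (EFst EVar))))
       (ECons (ESnd (EFst (EFst EVar)))
          (EApp (EInvWord (ESnd (EFst EVar))) (EInvWord (ESnd EVar))))).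

Definition closed_below_exp (n : nat) : exp :=
  EAllLt (ESucc EVar)
    (EAllLt (EConst (2 * n))
       (EExLt (ESucc (EFst (EFst EVar)))
          (EAllLt (ESucc (EFst (EFst (EFst EVar)))) (EOracle conj_word_exp)))).

(* Environment [<<<<w, bs>, M>, c>, b>]; the word is [c^-1 w c b^-1]. *)
Definition coset_word_exp : exp :=
  EApp (EInvWord (ESnd (EFst EVar)))
    (EApp (EFst (EFst (EFst (EFst EVar))))
       (EApp (ESnd (EFst EVar)) (EInvWord (ESnd EVar)))).

Definition conj_coset_exp : exp :=
  EExLt (ESucc (ESnd EVar)) (EExIn (ESnd (EFst (EFst EVar))) (EOracle coset_word_exp)).

Ltac word_den :=
  repeat match goal with
  | |- exp_den _ (EApp _ _) _ = _ => apply den_EApp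
  | |- exp_den _ (ECons _ _) _ = _ => apply den_ECons
  | |- exp_den _ (EInvWord _) _ = _ => apply den_EInvWord
  end;
  cbn [exp_den]; unpair_simpl; rewrite ?enc_dec_list; reflexivity.

Section Algorithm.
Variables (G : Group) (n : nat) (gens : nat -> G) (Hs : list G) (O : nat -> nat).
Hypothesis HO : forall c, nat_reflect (in_gen Hs (elt_of_code G n gens c)) (O c).
Local Notation el := (elt_of_code G n gens).
Local Notation ev := (eval_word gens).
Local Notation den := (exp_den O).

Lemma nat_reflect_conj_word M c a c' c'' : a < 2 * n ->
  nat_reflect (in_gen Hs (el c'' ** (el c ** eval_letter gens a ** ginv (el c')) ** ginv (el c'')))
    (den (EOracle conj_word_exp) (cpair (cpair (cpair (cpair M c) a) c') c'')).
Proof.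
  intros Ha. cbn [exp_den].
  assert (Hw : den conj_word_exp (cpair (cpair (cpair (cpair M c) a) c') c'') =
    enc_list (dec_list c'' ++ dec_list c ++ a ::
              rev (map flip_letter (dec_list c')) ++ rev (map flip_letter (dec_list c'')))).
  { unfold conj_word_exp. word_den. }
  rewrite Hw. eapply nat_reflect_iff; [| apply HO].
  rewrite elt_of_code_enc, !restrict_word_app, restrict_word_cons, !restrict_word_app,
    !restrict_word_inv, !eval_word_app, eval_word_cons, !eval_word_app, !eval_word_inv by exact Ha.
  unfold elt_of_code. gsimpl. reflexivity.
Qed.

Lemma nat_reflect_closed_below_exp M :
  nat_reflect (closed_below G n gens Hs M) (den (closed_below_exp n) M).
Proof.
  apply (nat_reflect_iff (forall c, c < S M -> forall a, a < 2 * n -> exists c', c' < S M /\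
           forall c'', c'' < S M ->
           in_gen Hs (el c'' ** (el c ** eval_letter gens a ** ginv (el c')) ** ginv (el c''))));
    [| unfold closed_below_exp;
       apply nat_reflect_EAllLt; [reflexivity | intros c Hc];
       apply nat_reflect_EAllLt; [apply den_EConst | intros a Ha];
       apply nat_reflect_EExLt; [cbn [exp_den]; unpair_simpl; reflexivity | intros c' Hc'];
       apply nat_reflect_EAllLt; [cbn [exp_den]; unpair_simpl; reflexivity | intros c'' Hc''];
       apply nat_reflect_conj_word; exact Ha].
  unfold closed_below, in_core_below, coded_below. split.
  - intros Hall v a [c [Hc ->]] Ha.
    destruct (Hall c ltac:(lia) a Ha) as [c' [Hc' Hz]].
    exists (el c'). split; [exists c'; split; [lia | reflexivity]|].
    intros u [c'' [Hc'' ->]]. apply Hz. lia.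
  - intros Hcl c Hc a Ha.
    destruct (Hcl (el c) a ltac:(exists c; split; [lia | reflexivity]) Ha)
      as [z [[c' [Hc' ->]] Hz]].
    exists c'. split; [lia|]. intros c'' Hc''. apply Hz. exists c''. split; [lia | reflexivity].
Qed.

Lemma nat_reflect_coset_word w bs M c b : word_ok n w -> word_ok n b ->
  nat_reflect (in_gen Hs (ginv (el c) ** ev w ** el c ** ginv (ev b)))
    (den (EOracle coset_word_exp) (cpair (cpair (cpair (cpair (enc_list w) bs) M) c) (enc_list b))).
Proof.
  intros Hw Hb. cbn [exp_den].
  assert (Hword :
    den coset_word_exp (cpair (cpair (cpair (cpair (enc_list w) bs) M) c) (enc_list b)) =
    enc_list (rev (map flip_letter (dec_list c)) ++ w ++ dec_list c ++ rev (map flip_letter b))).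
  { unfold coset_word_exp. word_den. }
  rewrite Hword. eapply nat_reflect_iff; [| apply HO].
  rewrite elt_of_code_enc, !restrict_word_app, !restrict_word_inv, !eval_word_app, !eval_word_inv,
    (restrict_word_id n w Hw), (restrict_word_id n b Hb).
  unfold elt_of_code. gsimpl. reflexivity.
Qed.

Hypothesis Hgen : generates n gens.

Lemma nat_reflect_conj_coset_exp M w bs :
  closed_below G n gens Hs M -> word_ok n w -> Forall (word_ok n) bs ->
  nat_reflect (exists x b, In b bs /\ in_gen Hs (ginv x ** ev w ** x ** ginv (ev b)))
    (den conj_coset_exp (cpair (cpair (enc_list w) (enc_words bs)) M)).
Proof.
  intros Hcl Hw Hbs. rewrite Forall_forall in Hbs.
  apply (nat_reflect_iff (exists c, c < S M /\ exists a, In a (map enc_list bs) /\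
           in_gen Hs (ginv (el c) ** ev w ** el c ** ginv (ev (dec_list a))))).
  - split.
    + intros [c [Hc [a [Ha Hin]]]]. apply in_map_iff in Ha as [b [<- Hb]].
      rewrite dec_enc_list in Hin. eauto.
    + intros [x [b [Hb Hx]]].
      destruct (proj1 (conj_coset_coded_below G n gens Hs Hgen M Hcl (ev w) (ev b))
                      (ex_intro _ x Hx)) as [z [[c [Hc ->]] Hz]].
      exists c. split; [lia|]. exists (enc_list b). rewrite dec_enc_list. auto using in_map.
  - apply nat_reflect_EExLt; [cbn [exp_den]; unpair_simpl; reflexivity | intros c Hc].
    apply nat_reflect_EExIn with (l := map enc_list bs);
      [cbn [exp_den]; unpair_simpl; reflexivity|].
    intros a Ha. apply in_map_iff in Ha as [b [<- Hb]]. rewrite dec_enc_list.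
    apply nat_reflect_coset_word; auto.
Qed.

End Algorithm.

(* The decider [p] is specified only on words over the [n] generators, hence the filtering;
   the filtering expression makes no oracle calls. *)
Definition oracle_prog (p : prog) (n : nat) : prog :=
  PComp p (PPair (compile PZero (EFilterLt (2 * n) EVar)) PFst).

Lemma peval_oracle_prog (G : Group) n (gens : nat -> G) p hs :
  (forall w, word_ok n w ->
     decides p (in_gen (map (eval_word gens) hs) (eval_word gens w))
       (cpair (enc_list w) (enc_words hs))) ->
  forall c, peval (oracle_prog p n) (cpair (enc_words hs) c)
              (indicator (in_gen (map (eval_word gens) hs) (elt_of_code G n gens c))).
Proof.
  intros Hp c. econstructor; [constructor; [| constructor] |].
  - pose proof (compile_correct PZero (fun _ => 0) (enc_words hs) (fun c => ev_zero _)
                  (EFilterLt (2 * n) EVar) c) as Hnorm.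
    rewrite (den_EFilterLt _ _ _ _ (dec_list c)) in Hnorm by (symmetry; apply enc_dec_list).
    exact Hnorm.
  - apply peval_of_decides with (1 := Hp _ (word_ok_restrict n _)), nat_reflect_indicator.
Qed.

Definition search_prog (orc : prog) (n : nat) : prog :=
  PMin (compile orc (ENot (closed_below_exp n))).

Lemma peval_search_prog (G : Group) n (gens : nat -> G) Hs orc O h M :
  (forall c, nat_reflect (in_gen Hs (elt_of_code G n gens c)) (O c)) ->
  (forall c, peval orc (cpair h c) (O c)) ->
  closed_below G n gens Hs M -> (forall m, closed_below G n gens Hs m -> M <= m) ->
  peval (search_prog orc n) h M.
Proof.
  intros HO Horc HM Hmin.
  assert (Hnot : forall m, nat_reflect (~ closed_below G n gens Hs m)
                             (exp_den O (ENot (closed_below_exp n)) m))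
    by (intros m; apply nat_reflect_ENot, nat_reflect_closed_below_exp, HO).
  apply peval_min_least with (F := exp_den O (ENot (closed_below_exp n))).
  - intros m. apply (compile_correct _ _ _ Horc).
  - apply (proj2 (Hnot M)). tauto.
  - intros m Hm. rewrite (proj1 (Hnot m)); [discriminate|].
    intros Hcl. specialize (Hmin m Hcl). lia.
Qed.

Definition gcp_prog (orc : prog) (n : nat) : prog :=
  PComp (compile orc conj_coset_exp)
    (PPair (PComp PFst PSnd)
       (PPair (PPair PFst (PComp PSnd PSnd)) (PComp (search_prog orc n) (PComp PFst PSnd)))).

Lemma peval_gcp_prog orc n O w h bs M :
  (forall c, peval orc (cpair h c) (O c)) -> peval (search_prog orc n) h M ->
  peval (gcp_prog orc n) (cpair w (cpair h bs)) (exp_den O conj_coset_exp (cpair (cpair w bs) M)).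
Proof.
  intros Horc Hsearch.
  assert (Hh : peval (PComp PFst PSnd) (cpair w (cpair h bs)) h) by repeat econstructor.
  econstructor; [| apply (compile_correct _ _ _ Horc)].
  constructor; [exact Hh|].
  constructor; [repeat econstructor | econstructor; [exact Hh | exact Hsearch]].
Qed.

Theorem proposition3p7 (G : Group) (n : nat) (gens : nat -> G)
  (Hgen : generates n gens) :
  MPfi_decidable n gens -> GCPRec_decidable n gens.
Proof.
  intros [p Hp]. exists (gcp_prog (oracle_prog p n) n).
  intros w hs bs Hw Hhs Hbs Hfi.
  set (Hs := map (eval_word gens) hs).
  set (O := fun c => indicator (in_gen Hs (elt_of_code G n gens c))).
  assert (HO : forall c, nat_reflect (in_gen Hs (elt_of_code G n gens c)) (O c))
    by (intros c; apply nat_reflect_indicator).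
  assert (Horc : forall c, peval (oracle_prog p n) (cpair (enc_words hs) c) (O c))
    by (apply peval_oracle_prog; intros u Hu; apply Hp; assumption).
  destruct (dec_inh_nat_subset_has_unique_least_element (closed_below G n gens Hs)
              (fun m => classic _) (exists_closed_below G n gens Hs Hgen Hfi))
    as [M [[HM Hmin] _]].
  eapply decides_of_peval.
  - apply peval_gcp_prog; [exact Horc |].
    exact (peval_search_prog G n gens Hs _ O _ M HO Horc HM Hmin).
  - exact (nat_reflect_conj_coset_exp G n gens Hs O HO Hgen M w bs HM Hw Hbs).
Qed.
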